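(* Let $M$ be a hemi-slant submanifold of a cosymplectic manifold $N$, with $TM = D^{\theta}\oplus D^{\perp}\oplus\langle\xi\rangle$. Then the slant distribution $D^{\theta}$ is integrable if and only if $$h(X,TY)-h(Y,TX)+\nabla^{\perp}_{X}FY-\nabla^{\perp}_{Y}FX\in\mu\oplus F(D^{\theta})$$ for all $X,Y\in D^{\theta}$.
   Context: An almost contact metric manifold is a $(2m+1)$-dimensional manifold $N$ with structure $(\phi,\xi,\eta,g)$, where $\phi$ is a $(1,1)$-tensor field, $\xi$ a vector field, $\eta$ a one-form and $g$ a Riemannian metric, satisfying $\phi^2=-I+\eta\otimes\xi$, $\eta(\xi)=1$, $g(\phi X,\phi Y)=g(X,Y)-\eta(X)\eta(Y)$; consequently $\phi\xi=0$, $\eta(\phi X)=0$, $\eta(X)=g(X,\xi)$, $g(\phi X,Y)+g(X,\phi Y)=0$. A normal almost contact metric manifold $N$ with Levi-Civita connection $\overline{\nabla}$ is called cosymplectic if $\overline{\nabla}_X\phi=0$ and $\overline{\nabla}_X\xi=0$ for all $X$. $M$ is a submanifold of $N$ with $\xi$ tangent to $M$, equipped with the induced metric. Write $\overline{\nabla}_XY=\nabla_XY+h(X,Y)$ and $\overline{\nabla}_XV=-A_VX+\nabla^{\perp}_XV$ for $X,Y$ tangent to $M$ and $V$ normal to $M$ (Gauss and Weingarten formulae), where $\nabla$ is the induced connection, $h$ the second fundamental form, $A$ the shape operator and $\nabla^\perp$ the normal connection. For $X$ tangent to $M$ write $\phi X=TX+FX$ with $TX$ tangent and $FX$ normal to $M$.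 $M$ is a hemi-slant submanifold if there are two orthogonal distributions $D^{\theta}$, $D^{\perp}$ on $M$ such that (i) $TM=D^{\theta}\oplus D^{\perp}\oplus\langle\xi\rangle$ (orthogonal sum), where $\langle\xi\rangle$ is the distribution spanned by $\xi$; (ii) $D^{\theta}$ is a slant distribution with slant angle $\theta\neq\frac{\pi}{2}$, i.e. for every $x\in M$ and every nonzero $X\in D^{\theta}_x$ the angle in $[0,\frac{\pi}{2}]$ between $\phi X$ and $T_xM$ equals the constant $\theta$; (iii) $D^{\perp}$ is totally real, i.e. $\phi D^{\perp}\subseteq T^{\perp}M$. $\mu$ denotes the orthogonal complement of $\phi TM$ in $T^{\perp}M$, i.e. the set of normal vectors orthogonal to $\phi(TM)$; the normal bundle decomposes orthogonally as $T^{\perp}M=F(D^{\perp})\oplus F(D^{\theta})\oplus\mu$. *)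

(* Defs.v *)
From HB Require Import structures.
From mathcomp Require Import all_boot all_order all_algebra.
From mathcomp Require Import all_classical all_reals all_analysis.

Set Implicit Arguments.
Unset Strict Implicit.
Unset Printing Implicit Defensive.

Import Order.TTheory GRing.Theory Num.Theory.
Import numFieldNormedType.Exports.

Local Open Scope classical_set_scope.
Local Open Scope ring_scope.

(* Vectors are rows and linear maps act on the right: [u *m A] is the image of
   [u] under [A], and a composition reads from left to right. *)

Section Smooth.
Context {R : realType} {V W : normedModType R}.

Fixpoint Ck (k : nat) (U : set V) (f : V -> W) : Prop :=
  match k with
  | 0 => forall x, U x -> {for x, continuous f}
  | k'.+1 => (forall x, U x -> differentiable f x) /\
             (forall v, Ck k' U (fun x => 'D_v f x))
  end.

(* Meant for open [U]. *)
Definition smooth_on (U : set V) (f : V -> W) : Prop := forall k, Ck k U f.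

End Smooth.

(* [param] is only meaningful on the open set [coord @` dom]. *)
Record chart (R : realType) (n : nat) (T : topologicalType) := Chart {
  dom : set T;
  coord :> T -> 'rV[R]_n;
  param : 'rV[R]_n -> T;
  dom_open : open dom;
  codom_open : open (coord @` dom);
  coordK : forall x, dom x -> param (coord x) = x;
  coord_continuous : forall x, dom x -> {for x, continuous coord};
  param_continuous : forall z, (coord @` dom) z -> {for z, continuous param}
}.

(* The atlas is {chart_at x | x}: a smooth atlas together with the choice, for
   each point x, of one of its charts around x.  Tangent vectors at x are
   represented by their components in the chart chosen at x, so that the tangent
   space at every point is 'rV[R]_n. *)
Record manifold (R : realType) (n : nat) := Manifold {
  point :> topologicalType;
  chart_at : point -> chart R n point;
  chart_at_dom : forall x, dom (chart_at x) x;
  chart_compat : forall x y,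
    smooth_on (chart_at x @` (dom (chart_at x) `&` dom (chart_at y)))
              (chart_at y \o param (chart_at x));
  manifold_hausdorff : hausdorff_space point;
  manifold_second_countable : @second_countable point
}.

Section Maps.
Context {R : realType} {k n : nat} {M : manifold R k} {N : manifold R n}.
Implicit Types (f : M -> N) (x : M).

(* [f] read in the charts chosen at p and q. *)
Definition loc (p : M) (q : N) f : 'rV[R]_k -> 'rV[R]_n :=
  chart_at q \o f \o param (chart_at p).

Definition loc_dom (p : M) (q : N) f (U : set M) : set 'rV[R]_k :=
  chart_at p @` (U `&` dom (chart_at p) `&` f @^-1` dom (chart_at q)).

Definition dloc (p : M) (q : N) f x : 'M[R]_(k, n) :=
  jacobian (loc p q f) (chart_at p x).

Definition smooth_map f : Prop :=
  continuous f /\ forall p q, smooth_on (loc_dom p q f setT) (loc p q f).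

(* The differential T_xM -> T_(f x)N. *)
Definition dmap f x : 'M[R]_(k, n) := dloc x (f x) f x.

Definition immersion f : Prop := smooth_map f /\ forall x, row_free (dmap f x).

End Maps.

(* Change of components at x from the chart chosen at p to the chart chosen at
   q.  The rows of [transition p x x] are thus the coordinate vectors of the
   chart at p, as elements of T_xN. *)
Definition transition {R : realType} {n : nat} {N : manifold R n} (p q x : N) :
    'M[R]_n :=
  dloc p q idfun x.

(* A vector field along f : M -> N assigns to x a vector of T_(f x)N; the vector
   fields on M are those along the identity. *)
Section Fields.
Context {R : realType} {k n : nat} {M : manifold R k} {N : manifold R n}.
Variable f : M -> N.
Implicit Types (x : M) (W : M -> 'rV[R]_n).

(* Components of W in the chart of N chosen at q, as functions of the
   coordinates of the chart of M chosen at p. *)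
Definition field_loc (p : M) (q : N) W (z : 'rV[R]_k) : 'rV[R]_n :=
  let x := param (chart_at p) z in W x *m transition (f x) q (f x).

Definition smooth_field (U : set M) W : Prop :=
  forall p q, smooth_on (loc_dom p q f U) (field_loc p q W).

(* Componentwise derivative at x of W in the direction v, in the charts chosen
   at x and f x; it depends on these charts. *)
Definition Dfield W x (v : 'rV[R]_k) : 'rV[R]_n :=
  'D_v (field_loc x (f x) W) (chart_at x x).

End Fields.

Section VectorFields.
Context {R : realType} {n : nat} {N : manifold R n}.
Implicit Types X Y : N -> 'rV[R]_n.

Definition vector_field (U : set N) X : Prop := smooth_field (@idfun N) U X.

Definition lie_bracket X Y (x : N) : 'rV[R]_n :=
  Dfield idfun Y x (X x) - Dfield idfun X x (Y x).

(* X a, for a scalar function a. *)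
Definition lie_deriv X (a : N -> R^o) (x : N) : R^o :=
  'D_(X x) (a \o param (chart_at x)) (chart_at x x).

End VectorFields.

(* Affine connection: [christoffel x u w] is Gamma^l_ij u^i w^j, with the
   Christoffel symbols at x in the chart chosen at x. *)
Record connection (R : realType) (n : nat) (N : manifold R n) := Connection {
  christoffel : N -> 'rV[R]_n -> 'rV[R]_n -> 'rV[R]_n;
  christoffel_linearl : forall x w, linear (fun u => christoffel x u w);
  christoffel_linearr : forall x u, linear (christoffel x u);
  christoffel_smooth : forall (U : set N) (X Y : N -> 'rV[R]_n),
    open U -> vector_field U X -> vector_field U Y ->
    vector_field U (fun x => Dfield idfun Y x (X x) + christoffel x (X x) (Y x))
}.

Section Covariant.
Context {R : realType} {k n : nat} {M : manifold R k} {N : manifold R n}.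

(* Covariant derivative, in the direction of the vector field X on M, of the
   field W along f. *)
Definition cov (nabla : connection N) (f : M -> N) (X : M -> 'rV[R]_k)
    (W : M -> 'rV[R]_n) (x : M) : 'rV[R]_n :=
  Dfield f W x (X x) + christoffel nabla (f x) (X x *m dmap f x) (W x).

End Covariant.

Definition scal {R : realType} {n : nat} (G : 'M[R]_n) (u v : 'rV[R]_n) : R :=
  (u *m G *m v^T) 0 0.

Definition gnorm {R : realType} {n : nat} (G : 'M[R]_n) (u : 'rV[R]_n) : R :=
  Num.sqrt (scal G u u).

(* Row space: the vectors orthogonal to all rows of A. *)
Definition orthc {R : realType} {n r : nat} (G : 'M[R]_n) (A : 'M[R]_(r, n)) :
    'M[R]_n :=
  kermx (G *m A^T).

Record metric (R : realType) (n : nat) (N : manifold R n) := Metric {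
  gram :> N -> 'M[R]_n;
  gram_sym : forall x, (gram x)^T = gram x;
  gram_pos : forall x u, u != 0 -> 0 < scal (gram x) u u;
  gram_smooth : forall p,
    smooth_on (chart_at p @` dom (chart_at p))
      (fun z => let x := param (chart_at p) z in
        transition p x x *m gram x *m (transition p x x)^T)
}.

Definition levi_civita (R : realType) (n : nat) (N : manifold R n)
    (g : metric N) (nabla : connection N) : Prop :=
  forall (U : set N) (X Y Z : N -> 'rV[R]_n), open U ->
    vector_field U X -> vector_field U Y -> vector_field U Z ->
    forall x, U x ->
      cov nabla idfun X Y x - cov nabla idfun Y X x = lie_bracket X Y x /\
      lie_deriv X (fun y => scal (g y) (Y y) (Z y)) x =
        scal (g x) (cov nabla idfun X Y x) (Z x) +
        scal (g x) (Y x) (cov nabla idfun X Z x).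

(* phi X is [X x *m phi x], and eta(X) is the 1 x 1 matrix [X x *m eta x]. *)
Record almost_contact_metric (R : realType) (m : nat)
    (N : manifold R (2 * m).+1) := AlmostContactMetric {
  phi : N -> 'M[R]_((2 * m).+1);
  xi : N -> 'rV[R]_((2 * m).+1);
  eta : N -> 'cV[R]_((2 * m).+1);
  acm_metric :> metric N;
  phi_smooth : forall p,
    smooth_on (chart_at p @` dom (chart_at p))
      (fun z => let x := param (chart_at p) z in
        transition p x x *m phi x *m transition x p x);
  xi_smooth : vector_field setT xi;
  eta_smooth : forall p,
    smooth_on (chart_at p @` dom (chart_at p))
      (fun z => let x := param (chart_at p) z in transition p x x *m eta x);
  phi_sqr : forall x (u : 'rV[R]_((2 * m).+1)),
    u *m phi x *m phi x = - u + (u *m eta x) *m xi x;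
  eta_xi : forall x, (xi x *m eta x) 0 0 = 1;
  phi_metric : forall x (u v : 'rV[R]_((2 * m).+1)),
    scal (acm_metric x) (u *m phi x) (v *m phi x) =
    scal (acm_metric x) u v - (u *m eta x) 0 0 * (v *m eta x) 0 0
}.

Section Cosymplectic.
Context {R : realType} {m : nat} {N : manifold R (2 * m).+1}.
Variable S : almost_contact_metric N.
Implicit Types X Y : N -> 'rV[R]_((2 * m).+1).

Definition phi_field X : N -> 'rV[R]_((2 * m).+1) := fun x => X x *m phi S x.

Definition eta_field X : N -> R^o := fun x => (X x *m eta S x) 0 0.

Definition nijenhuis X Y (x : N) : 'rV[R]_((2 * m).+1) :=
  phi_field (phi_field (lie_bracket X Y)) x
  + lie_bracket (phi_field X) (phi_field Y) x
  - phi_field (lie_bracket (phi_field X) Y) x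
  - phi_field (lie_bracket X (phi_field Y)) x.

(* 2 d eta (X, Y), with the convention that includes the factor 1/2 in d. *)
Definition two_d_eta X Y (x : N) : R :=
  lie_deriv X (eta_field Y) x - lie_deriv Y (eta_field X) x
  - eta_field (lie_bracket X Y) x.

Definition acm_normal : Prop :=
  forall (U : set N) X Y, open U -> vector_field U X -> vector_field U Y ->
    forall x, U x -> nijenhuis X Y x + two_d_eta X Y x *: xi S x = 0.

Definition cosymplectic (nabla : connection N) : Prop :=
  acm_normal /\
  (forall (U : set N) X Y, open U -> vector_field U X -> vector_field U Y ->
     forall x, U x ->
       cov nabla idfun X (phi_field Y) x
         - phi_field (cov nabla idfun X Y) x = 0) /\
  (forall (U : set N) X, open U -> vector_field U X ->
     forall x, U x -> cov nabla idfun X (xi S) x = 0).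

End Cosymplectic.

(* The fibre at x is the row space of [D x]. *)
Section Distributions.
Context {R : realType} {k : nat} {M : manifold R k}.
Variable D : M -> 'M[R]_k.

Definition distribution : Prop :=
  exists r : nat, (forall x, \rank (D x) = r) /\
    forall x, exists (U : set M) (E : 'I_r -> M -> 'rV[R]_k),
      [/\ open U, U x, forall i, vector_field U (E i) &
          forall y, U y -> (D y == \matrix_i E i y)%MS].

Definition section_on (U : set M) (X : M -> 'rV[R]_k) : Prop :=
  vector_field U X /\ forall x, U x -> (X x <= D x)%MS.

Definition integrable_distribution : Prop :=
  forall (U : set M) X Y, open U -> section_on U X -> section_on U Y ->
    forall x, U x -> (lie_bracket X Y x <= D x)%MS.

End Distributions.

Section Submanifold.
Context {R : realType} {m k : nat} {N : manifold R (2 * m).+1}.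
Context {M : manifold R k}.
Variables (S : almost_contact_metric N) (nabla : connection N) (iota : M -> N).
Implicit Types (x : M) (X Y : M -> 'rV[R]_k).

(* T_xM as a subspace of T_(iota x)N is the row space of [dmap iota x]. *)

Definition induced_metric x : 'M[R]_k :=
  dmap iota x *m S (iota x) *m (dmap iota x)^T.

Definition normal_space x : 'M[R]_((2 * m).+1) :=
  orthc (S (iota x)) (dmap iota x).

(* The vector u of T_xM such that w - d iota (u) is orthogonal to T_xM, from the
   normal equations. *)
Definition tan_part x (w : 'rV[R]_((2 * m).+1)) : 'rV[R]_k :=
  w *m S (iota x) *m (dmap iota x)^T *m invmx (induced_metric x).

Definition nor_part x (w : 'rV[R]_((2 * m).+1)) : 'rV[R]_((2 * m).+1) :=
  w - tan_part x w *m dmap iota x.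

Definition phi_tan x (u : 'rV[R]_k) : 'rV[R]_((2 * m).+1) :=
  u *m dmap iota x *m phi S (iota x).

Definition Tpart X : M -> 'rV[R]_k := fun x => tan_part x (phi_tan x (X x)).

Definition Fpart X : M -> 'rV[R]_((2 * m).+1) :=
  fun x => nor_part x (phi_tan x (X x)).

(* The second fundamental form h(X, Y). *)
Definition sff X Y x : 'rV[R]_((2 * m).+1) :=
  nor_part x (cov nabla iota X (fun y => Y y *m dmap iota y) x).

(* The normal connection, for V normal to M. *)
Definition nabla_perp X (V : M -> 'rV[R]_((2 * m).+1)) x :
    'rV[R]_((2 * m).+1) :=
  nor_part x (cov nabla iota X V x).

Definition Fimage (D : M -> 'M[R]_k) x : 'M[R]_(k, (2 * m).+1) :=
  \matrix_i nor_part x (phi_tan x (row i (D x))).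

Definition mu x : 'M[R]_((2 * m).+1) :=
  (normal_space x :&:
   orthc (S (iota x)) (dmap iota x *m phi S (iota x)))%MS.

(* Angle in [0, pi/2] between a nonzero vector w and T_xM. *)
Definition angle_tangent x (w : 'rV[R]_((2 * m).+1)) : R :=
  acos (gnorm (S (iota x)) (tan_part x w *m dmap iota x)
        / gnorm (S (iota x)) w).

Definition slant_distribution (D : M -> 'M[R]_k) (theta : R) : Prop :=
  distribution D /\
  forall x (u : 'rV[R]_k), u != 0 -> (u <= D x)%MS ->
    angle_tangent x (phi_tan x u) = theta.

Definition totally_real (D : M -> 'M[R]_k) : Prop :=
  distribution D /\
  forall x (u : 'rV[R]_k), (u <= D x)%MS -> (phi_tan x u <= normal_space x)%MS.

Definition xi_tangent : Prop :=
  forall x, (xi S (iota x) <= dmap iota x)%MS.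

Definition xi_on x : 'rV[R]_k := tan_part x (xi S (iota x)).

Definition orthogonal_at x (r s : nat) (A : 'M[R]_(r, k)) (B : 'M[R]_(s, k)) :
    Prop :=
  (A <= orthc (induced_metric x) B)%MS.

Definition hemi_slant (Dtheta Dperp : M -> 'M[R]_k) (theta : R) : Prop :=
  [/\ forall x, (Dtheta x + Dperp x + xi_on x == 1%:M)%MS,
      forall x, [/\ orthogonal_at x (Dtheta x) (Dperp x),
                    orthogonal_at x (Dtheta x) (xi_on x) &
                    orthogonal_at x (Dperp x) (xi_on x)],
      0 <= theta <= pi / 2 /\ theta <> pi / 2,
      slant_distribution Dtheta theta &
      totally_real Dperp].

End Submanifold.

(* Main.v *)
Require Import Defs.
From mathcomp Require Import all_boot all_order all_algebra.
From mathcomp Require Import all_classical all_reals all_analysis.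
From mathcomp Require Import ring.

(* Since phi is parallel along iota (the chain rule carries this over from
   vector fields on open subsets of N to fields along iota), adding the Gauss
   formula for TY and the Weingarten formula for FY gives
   h(X, TY) + nabla^perp_X FY = nor (phi (nabla_X Y)), the covariant derivative
   being that of N; as it is torsion-free, the expression of the theorem is
   F[X, Y].  For X, Y in D^theta one has phi (phi Y) = - Y, so differentiating
   twice through phi gives phi^2 (nabla_X Y) = - nabla_X Y: the bracket is
   orthogonal to xi, say [X, Y] = a + b with a in D^theta and b in D^perp.
   Finally F b = phi b is orthogonal to mu and to F(D^theta), so that F[X, Y]
   lies in mu + F(D^theta) only if phi b = 0, that is b = 0. *)

Set Implicit Arguments.
Unset Strict Implicit.
Unset Printing Implicit Defensive.

Import Order.TTheory GRing.Theory Num.Theory.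
Import numFieldNormedType.Exports.

Local Open Scope classical_set_scope.
Local Open Scope ring_scope.

(** * Differentiability of matrix-valued maps *)

Section MatrixDifferential.
Context {R : realType} {V : normedModType R}.

(** Write [g = f + (g - f)]: the second summand vanishes near [x], so the zero map [z] satisfies the
    defining expansion of its differential. *)
Lemma near_eq_differentiable (W : normedModType R) (f g : V -> W) x :
  (\near x, f x = g x) -> differentiable f x -> differentiable g x.
Proof.
move=> fg df; have -> : g = f + (g - f) by rewrite addrC subrK.
apply: differentiableD => //.
have h0 : \forall y \near x, (g - f) y = 0.
  by near=> y; have -> : (g - f) y = g y - f y by []; rewrite (near fg y)// subrr.
pose z : {linear V -> W} := \0.
have zc : continuous z by move=> y; exact: cvg_cst.
have E : (g - f) \o shift x = cst ((g - f) x) + z +o_ (0 : V) id.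
  apply/eqaddoP => e e0; near=> y.
  rewrite [X in `|X|](_ : _ = 0) ?normr0 ?mulr_ge0 ?(ltW e0)//.
  rewrite -[LHS]/((g - f) (y + x) - ((g - f) x + 0)) (nbhs_singleton h0) addr0 subr0.
  near: y; move: h0; rewrite (near_shift 0) subr0; exact.
by apply/diff_locallyP; rewrite (diff_unique zc E); split.
Unshelve. all: by end_near. Qed.

Lemma differentiable_mxP m n (A : V -> 'M[R]_(m, n)) x :
  differentiable A x <-> forall i j, differentiable (fun y => A y i j) x.
Proof.
split=> [dA i j|dA].
  exact: (differentiable_comp dA (differentiable_coord _ i j)).
have -> : A = \sum_i \sum_j (fun y => A y i j *: delta_mx i j).
  apply/funext => y; rewrite [LHS]matrix_sum_delta fct_sumE.
  by apply: eq_bigr => i _; rewrite fct_sumE.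
apply: differentiable_sum => i; apply: differentiable_sum => j.
exact: differentiableZl.
Qed.

Lemma differentiable_mulmx m n p (A : V -> 'M[R]_(m, n)) (B : V -> 'M[R]_(n, p)) x :
  differentiable A x -> differentiable B x ->
  differentiable (fun y => A y *m B y) x.
Proof.
move=> /differentiable_mxP dA /differentiable_mxP dB.
apply/differentiable_mxP => i j.
have -> : (fun y => (A y *m B y) i j) = \sum_l (fun y => A y i l * B y l j).
  by apply/funext => y; rewrite mxE fct_sumE.
by apply: differentiable_sum => l; apply: differentiableM.
Qed.

Lemma derive_mulmx m n p (A : V -> 'M[R]_(m, n)) (B : V -> 'M[R]_(n, p)) x v :
  differentiable A x -> differentiable B x ->
  'D_v (fun y => A y *m B y) x = 'D_v A x *m B x + A x *m 'D_v B x.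
Proof.
move=> dA dB; have dAB := differentiable_mulmx dA dB.
rewrite !derive_mx; try exact: diff_derivable.
apply/matrixP => i j; rewrite !mxE.
have -> : (fun y => (A y *m B y) i j) = \sum_l (fun y => A y i l * B y l j).
  by apply/funext => y; rewrite mxE fct_sumE.
move: dA dB => /differentiable_mxP dA /differentiable_mxP dB.
rewrite derive_sum; last first.
  by move=> l; apply: diff_derivable; apply: differentiableM.
rewrite -big_split /=; apply: eq_bigr => l _; rewrite !mxE.
rewrite deriveM; try exact: diff_derivable.
by rewrite addrC; congr (_ + _); rewrite [LHS]mulrC.
Qed.

Lemma differentiable_trmx m n (A : V -> 'M[R]_(m, n)) x :
  differentiable A x -> differentiable (fun y => (A y)^T) x.
Proof.
move=> /differentiable_mxP dA; apply/differentiable_mxP => i j.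
by under eq_fun do rewrite mxE.
Qed.

Lemma differentiable_prod I (r : seq I) (f : I -> V -> R) x :
  (forall i, differentiable (f i) x) ->
  differentiable (fun y => \prod_(i <- r) f i y) x.
Proof.
move=> df; elim: r => [|i r IHr].
  by under eq_fun do rewrite big_nil; exact: differentiable_cst.
by under eq_fun do rewrite big_cons; apply: differentiableM.
Qed.

Lemma differentiable_det n (A : V -> 'M[R]_n) x :
  differentiable A x -> differentiable (fun y => \det (A y)) x.
Proof.
move=> /differentiable_mxP dA.
rewrite /determinant; elim: (index_enum _) => [|s r IHr].
  by under eq_fun do rewrite big_nil; exact: differentiable_cst.
under eq_fun do rewrite big_cons; apply: differentiableD => //.
by apply: differentiableM => //; apply: differentiable_prod.
Qed.

(** The inverse is the adjugate divided by the determinant, and both are polynomial in the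
    entries. *)
Lemma differentiable_invmx n (A : V -> 'M[R]_n) x :
  A x \in unitmx -> differentiable A x -> differentiable (fun y => invmx (A y)) x.
Proof.
move=> uA dA; have ddet := differentiable_det dA.
have det0 : \det (A x) != 0 by rewrite -unitfE -unitmxE.
apply: (@near_eq_differentiable _ (fun y => (\det (A y))^-1 *: \adj (A y))).
  (* [invmx] returns its argument on singular matrices, so the adjugate formula is only claimed near
     [x], where the determinant stays nonzero by continuity. *)
  have : \forall y \near x, \det (A y) != 0.
    have /= c := differentiable_continuous ddet; exact: (cvgr_neq0 _ c).
  by apply: filterS => y dy; rewrite /invmx unitmxE unitfE dy.
apply/differentiable_mxP => i j; under eq_fun do rewrite !mxE.
apply: differentiableM; first exact: differentiableV.
apply: differentiableM => //; apply: differentiable_det.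
move/differentiable_mxP : dA => dA; apply/differentiable_mxP => a b.
by under eq_fun do rewrite !mxE.
Qed.

End MatrixDifferential.

(** * Calculus of C^k maps and of Jacobians *)

Section CkTheory.
Context {R : realType}.

Lemma near_eq_on (T : topologicalType) (S : Type) (U : set T) (f g : T -> S) x :
  open U -> U x -> (forall y, U y -> f y = g y) -> \near x, f x = g x.
Proof. by move=> oU Ux fg; apply: filterS (open_nbhs_nbhs (conj oU Ux)). Qed.

Lemma CkW {V W : normedModType R} k (U : set V) (f : V -> W) :
  Ck k.+1 U f -> Ck k U f.
Proof.
elim: k f => [|k IHk] f [df Df]; last by split=> // v; exact: IHk.
by move=> x Ux; exact/differentiable_continuous/df.
Qed.

Lemma Ck_sub {V W : normedModType R} k (U U' : set V) (f : V -> W) :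
  U `<=` U' -> Ck k U' f -> Ck k U f.
Proof.
move=> UU'; elim: k f => [|k IHk] f; first by move=> cf x /UU'; exact: cf.
by move=> [df Df]; split=> [x /UU'|v]; [exact: df|exact: IHk (Df v)].
Qed.

(** As [U] is open, equality on [U] is equality near each of its points, so it passes to directional
    derivatives and the induction goes on. *)
Lemma eq_Ck {V W : normedModType R} k (U : set V) (f g : V -> W) :
  open U -> (forall x, U x -> f x = g x) -> Ck k U f -> Ck k U g.
Proof.
move=> oU; elim: k f g => [|k IHk] f g fg.
  move=> cf x Ux; rewrite /prop_for /continuous_at -(fg _ Ux).
  exact: cvg_trans (near_eq_cvg (near_eq_on oU Ux fg)) (cf x Ux).
move=> [df Df]; split=> [x Ux|v].
  exact: near_eq_differentiable (near_eq_on oU Ux fg) (df x Ux).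
apply: (IHk _ _ _ (Df v)) => x Ux.
exact/near_eq_derive/near_eq_on/fg.
Qed.

Lemma Ck_cst {V W : normedModType R} k (U : set V) (w : W) :
  Ck k U (fun=> w).
Proof.
elim: k w => [|k IHk] w; first by move=> x _; exact: cvg_cst.
split=> [x _|v]; first exact: differentiable_cst.
by under eq_fun do rewrite derive_cst; exact: IHk.
Qed.

Lemma CkD {V W : normedModType R} k (U : set V) (f g : V -> W) :
  open U -> Ck k U f -> Ck k U g -> Ck k U (fun x => f x + g x).
Proof.
move=> oU; elim: k f g => [|k IHk] f g.
  by move=> cf cg x Ux; apply: cvgD; [exact: cf|exact: cg].
move=> [df Df] [dg Dg]; split=> [x Ux|v].
  by apply: differentiableD; [exact: df|exact: dg].
apply: (eq_Ck oU _ (IHk _ _ (Df v) (Dg v))) => x Ux.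
by rewrite -deriveD; [|exact/diff_derivable/df|exact/diff_derivable/dg].
Qed.

Lemma Ck_sum {V W : normedModType R} k (U : set V) n (f : 'I_n -> V -> W) :
  open U -> (forall i, Ck k U (f i)) -> Ck k U (fun x => \sum_i f i x).
Proof.
move=> oU Cf; elim: (index_enum _) => [|i r IHr].
  by under eq_fun do rewrite big_nil; exact: Ck_cst.
by under eq_fun do rewrite big_cons; exact: CkD.
Qed.

Lemma Ck_mulmx {V : normedModType R} k (U : set V) m n p
    (A : V -> 'M[R]_(m, n)) (B : V -> 'M[R]_(n, p)) :
  open U -> Ck k U A -> Ck k U B -> Ck k U (fun x => A x *m B x).
Proof.
move=> oU; elim: k A B => [|k IHk] A B.
  move=> cA cB x Ux.
  (* Joint continuity of the matrix product comes from its differentiability on the product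
     space. *)
  have d : differentiable (fun q : 'M[R]_(m, n) * 'M[R]_(n, p) => q.1 *m q.2)
      (A x, B x).
    by apply: differentiable_mulmx; apply: linear_differentiable => q;
      [exact: cvg_fst|exact: cvg_snd].
  exact: continuous2_cvg (differentiable_continuous d) (cA x Ux) (cB x Ux).
move=> CA CB; have [[dA DA] [dB DB]] := (CA, CB); split=> [x Ux|v].
  by apply: differentiable_mulmx; [exact: dA|exact: dB].
have /eq_Ck := CkD oU (IHk _ _ (DA v) (CkW CB)) (IHk _ _ (CkW CA) (DB v)).
apply=> // x Ux; rewrite derive_mulmx//; [exact: dA|exact: dB].
Qed.

(** In this form the Jacobian is a sum of products of constant matrices with directional
    derivatives, which is what [Ck] controls. *)
Lemma jacobianE n m (f : 'rV[R]_n -> 'rV[R]_m) x : differentiable f x ->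
  jacobian f x = \sum_i delta_mx i 0 *m 'D_(delta_mx 0 i) f x.
Proof.
move=> df; under eq_bigr do rewrite deriveEjacobian//.
apply/row_matrixP => i; rewrite !rowE mulmx_sumr (bigD1 i)//= big1 => [|j ji].
  by rewrite addr0 !mulmxA !mul_delta_mx.
by rewrite mulmxA mul_delta_mx_0 1?eq_sym// mul0mx.
Qed.

Lemma Ck_jacobian k n m (U : set 'rV[R]_n) (f : 'rV[R]_n -> 'rV[R]_m) :
  open U -> Ck k.+1 U f -> Ck k U (jacobian f).
Proof.
move=> oU [df Df]; pose D i : 'rV[R]_n -> 'M[R]_(n, m) :=
  fun x => (delta_mx i 0 : 'cV_n) *m 'D_(delta_mx 0 i) f x.
have : Ck k U (fun x => \sum_i D i x).
  by apply: Ck_sum => // i; apply: Ck_mulmx => //; [exact: Ck_cst|exact: Df].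
by apply: eq_Ck => // x Ux; rewrite jacobianE//; exact: df.
Qed.

Lemma derive_comp (V : normedModType R) n m (f : V -> 'rV[R]_n)
    (g : 'rV[R]_n -> 'rV[R]_m) x v :
  differentiable f x -> differentiable g (f x) ->
  'D_v (g \o f) x = 'D_v f x *m jacobian g (f x).
Proof.
move=> df dg; rewrite !deriveE//; last exact: differentiable_comp.
by rewrite diff_comp//= mul_rV_lin1.
Qed.

Lemma jacobian_comp l n m (f : 'rV[R]_l -> 'rV[R]_n) (g : 'rV[R]_n -> 'rV[R]_m) x :
  differentiable f x -> differentiable g (f x) ->
  jacobian (g \o f) x = jacobian f x *m jacobian g (f x).
Proof.
move=> df dg; apply/row_matrixP => i; rewrite !rowE.
rewrite -deriveEjacobian; last exact: differentiable_comp.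
by rewrite derive_comp// (deriveEjacobian _ df) mulmxA.
Qed.

Lemma jacobian_id n (x : 'rV[R]_n) : jacobian id x = 1%:M.
Proof.
by apply/row_matrixP => i; rewrite !rowE -deriveEjacobian// derive_id mulmx1.
Qed.

Lemma near_eq_jacobian n m (f g : 'rV[R]_n -> 'rV[R]_m) x :
  (\near x, f x = g x) -> differentiable f x -> jacobian f x = jacobian g x.
Proof.
move=> fg df; have dg := near_eq_differentiable fg df.
have rowJ (h : 'rV[R]_n -> 'rV[R]_m) i : differentiable h x ->
    row i (jacobian h x) = 'D_(delta_mx 0 i) h x.
  by move=> dh; rewrite rowE -deriveEjacobian.
apply/row_matrixP => i; apply: etrans (rowJ f i df) _.
have E : 'D_(delta_mx 0 i : 'rV_n) f x = 'D_(delta_mx 0 i) g x.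
  exact: near_eq_derive.
by apply: (etrans E); apply: esym; exact: rowJ.
Qed.

(** By the chain rule, a derivative of [g \o f] is a sum of products of a derivative of [f] with
    partial derivatives of [g] composed with [f]; the induction hypothesis applies to these
    compositions. *)
Lemma Ck_comp k l n m (U : set 'rV[R]_l) (U' : set 'rV[R]_n)
    (f : 'rV[R]_l -> 'rV[R]_n) (g : 'rV[R]_n -> 'rV[R]_m) :
  open U -> open U' -> (forall x, U x -> U' (f x)) -> Ck k U f -> Ck k U' g ->
  Ck k U (g \o f).
Proof.
move=> oU oU' UU'; elim: k f g UU' => [|k IHk] f g UU' Cf Cg.
  by move=> x Ux; apply: continuous_comp; [exact: Cf|apply: Cg; exact: UU'].
have [[df Df] [dg Dg]] := (Cf, Cg); split=> [x Ux|v].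
  by apply: differentiable_comp; [exact: df|apply: dg; exact: UU'].
pose D i : 'rV[R]_l -> 'rV[R]_m := fun x => 'D_v f x *m (delta_mx i 0 : 'cV_n)
  *m ('D_(delta_mx 0 i) g \o f) x.
have : Ck k U (fun x => \sum_i D i x).
  apply: Ck_sum => // i; apply: Ck_mulmx => //.
    by apply: Ck_mulmx => //; [exact: Df|exact: Ck_cst].
  by apply: IHk => //; [exact: CkW|exact: Dg].
apply: eq_Ck => // x Ux; rewrite derive_comp; [|exact: df|by apply: dg; exact: UU'].
rewrite jacobianE; last by apply: dg; exact: UU'.
by rewrite mulmx_sumr; apply: eq_bigr => i _; rewrite mulmxA.
Qed.

End CkTheory.

(** * Symmetry of second derivatives *)

Section Schwarz.
Context {R : realType} {V : normedModType R}.

Lemma is_derive_line (f : V -> R) x u t : differentiable f (x + t *: u) ->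
  is_derive t 1 (fun t => f (x + t *: u)) ('D_u f (x + t *: u)).
Proof.
move=> df.
have E : (fun h : R => h^-1 *: (((fun t => f (x + t *: u)) \o shift t) (h *: 1)
      - f (x + t *: u)))
    = (fun h => h^-1 *: ((f \o shift (x + t *: u)) (h *: u) - f (x + t *: u))).
  apply/funext => h /=; congr (_ *: (f _ - _)).
  by rewrite [_ *: 1]mulr1 scalerDl addrCA.
split; first by rewrite /derivable E; exact/diff_derivable.
by rewrite /derive E.
Qed.

(* The left-hand side is symmetric in u and v. *)
Lemma second_difference_MVT (U : set V) (f : V -> R) x u v s : 0 < s ->
  (forall a b, 0 <= a <= s -> 0 <= b <= s -> U (x + a *: u + b *: v)) ->
  Ck 2 U f ->
  exists a b, [/\ 0 <= a <= s, 0 <= b <= s &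
    f (x + s *: u + s *: v) - f (x + s *: v) - f (x + s *: u) + f x =
    s ^+ 2 * 'D_v ('D_u f) (x + a *: u + b *: v)].
Proof.
move=> s0 US [df /(_ u) [dDf _]].
have s0s : 0 <= s <= s by rewrite lexx (ltW s0).
have z0s : 0 <= (0 : R) <= s by rewrite lexx (ltW s0).
(* [F s - F 0] is the second difference. One mean value theorem along [u] turns it into [s] times
   the difference [dF a] of first derivatives, and a second one along [v] produces the mixed
   derivative. *)
pose F (t : R) := f ((x + s *: v) + t *: u) - f (x + t *: u).
pose dF t := 'D_u f ((x + s *: v) + t *: u) - 'D_u f (x + t *: u).
have FD t : 0 <= t <= s -> is_derive t 1 F (dF t).
  move=> ts; apply: is_deriveB; apply: is_derive_line; apply: df.
    by rewrite addrAC; exact: US.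
  by rewrite -[_ + _]addr0 -(scale0r v); exact: US.
have [a as_ Fa] : exists2 a, 0 <= a <= s & F s - F 0 = dF a * s.
  have [||a as_ ->] := @MVT_segment _ F dF 0 s (ltW s0).
  - by move=> t; rewrite in_itv/= => /andP[t0 ts]; apply: FD; rewrite (ltW t0) (ltW ts).
  - apply: derivable_within_continuous => t; rewrite in_itv/= => ts.
    by have [] := FD t ts.
  by exists a; rewrite ?subr0//; move: as_; rewrite in_itv.
pose G (t : R) := 'D_u f ((x + a *: u) + t *: v).
pose dG (t : R) := 'D_v ('D_u f) ((x + a *: u) + t *: v).
have GD t : 0 <= t <= s -> is_derive t 1 G (dG t).
  by move=> ts; apply: is_derive_line; apply: dDf; exact: US.
have [b bs Gb] : exists2 b, 0 <= b <= s &
G s - G 0 = dG b * s.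
  have [||b bs ->] := @MVT_segment _ G dG 0 s (ltW s0).
  - by move=> t; rewrite in_itv/= => /andP[t0 ts]; apply: GD; rewrite (ltW t0) (ltW ts).
  - apply: derivable_within_continuous => t; rewrite in_itv/= => ts.
    by have [] := GD t ts.
  by exists b; rewrite ?subr0//; move: bs; rewrite in_itv.
exists a, b; split=> //; rewrite expr2 -mulrA [s * 'D_v _ _]mulrC -[X in X * s]/(dG b) -Gb mulrC.
have -> : G s - G 0 = dF a.
  by rewrite /G /dF scale0r addr0 addrAC.
rewrite -Fa /F !scale0r !addr0 [x + s *: v + _]addrAC.
ring.
Qed.

(** If the two mixed derivatives at [x] were at distance [2 * e], then by continuity each would stay
    within [e] of its value at [x] on a small parallelogram. The symmetric second difference equals
    [s ^+ 2] times a value of either one, which forces two such values to coincide. *)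
Lemma derive_comm_scalar (U : set V) (f : V -> R) x u v :
  open U -> U x -> Ck 2 U f -> 'D_u ('D_v f) x = 'D_v ('D_u f) x.
Proof.
move=> oU Ux Cf; apply/eqP; rewrite -subr_eq0; apply/negP => /negP ne.
set e := `|'D_u ('D_v f) x - 'D_v ('D_u f) x| / 2.
have e0 : 0 < e by rewrite divr_gt0// normr_gt0.
have cvu w1 w2 : \forall y \near x, `|'D_w1 ('D_w2 f) x - 'D_w1 ('D_w2 f) y| < e.
  have [_ /(_ w2) [_ /(_ w1) c]] := Cf.
  by have /= := (cvgrPdist_lt _ _).1 (c x Ux); exact.
have : \forall y \near x, [/\ U y, `|'D_u ('D_v f) x - 'D_u ('D_v f) y| < e &
    `|'D_v ('D_u f) x - 'D_v ('D_u f) y| < e].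
  have oxU : \forall y \near x, U y by exact: open_nbhs_nbhs.
  by apply: filterS3 oxU (cvu u v) (cvu v u) => y Uy h1 h2; split.
move=> /nbhs_normP[r /= r0 rP].
(* This makes the parallelogram with sides [s *: u] and [s *: v] fit in the ball of radius [r]; the
   summand 1 keeps the denominator positive when [u] and [v] vanish. *)
pose s := r / (`|u| + `|v| + 1).
have n0 : 0 < `|u| + `|v| + 1 by rewrite ltr_pwDr// addr_ge0.
have s0 : 0 < s by rewrite divr_gt0.
have inball w1 w2 a b : `|w1| + `|w2| = `|u| + `|v| ->
    0 <= a <= s -> 0 <= b <= s -> ball_ Num.norm x r (x + a *: w1 + b *: w2).
  move=> E /andP[a0 as_] /andP[b0 bs].
  rewrite /ball_/= !opprD !addrA subrr add0r -opprD normrN.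
  apply: (le_lt_trans (ler_normD _ _)); rewrite !normrZ !ger0_norm//.
  apply: (@le_lt_trans _ _ (s * (`|w1| + `|w2|))).
    by rewrite mulrDr lerD// ler_wpM2r.
  by rewrite E /s mulrAC ltr_pdivrMr// ltr_pM2l// ltrDl.
have [|a [b [as_ bs E1]]] := @second_difference_MVT U f x u v s s0 _ Cf.
  by move=> a b a0 b0; have /rP[] := inball u v a b erefl a0 b0.
have [|c [d [cs ds E2]]] := @second_difference_MVT U f x v u s s0 _ Cf.
  by move=> a' b' a0 b0; have /rP[] := inball v u a' b' (addrC _ _) a0 b0.
have [_ _ h1] := rP _ (inball u v a b erefl as_ bs).
have [_ h2 _] := rP _ (inball v u c d (addrC _ _) cs ds).
(* Both sides, multiplied by [s ^+ 2], are the same second difference. *)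
have E3 : 'D_v ('D_u f) (x + a *: u + b *: v) = 'D_u ('D_v f) (x + c *: v + d *: u).
  apply: (mulfI (_ : s ^+ 2 != 0)); first by rewrite expf_neq0// gt_eqF.
  by rewrite -E1 -E2 [x + s *: v + _]addrAC; ring.
rewrite E3 distrC in h1.
have := ltr_leD h2 (ltW h1); rewrite -splitr => /(le_lt_trans (ler_normD _ _)).
by rewrite addrA subrK ltxx.
Qed.

Lemma Ck_coord k m n (U : set V) (A : V -> 'M[R]_(m, n)) i j :
  open U -> Ck k U A -> Ck k U (fun x => A x i j).
Proof.
move=> oU; elim: k A => [|k IHk] A.
  move=> cA x Ux.
  exact: (continuous_comp (cA x Ux) (@coord_continuous _ _ _ i j (A x))).
move=> [dA DA]; split=> [x /dA /differentiable_mxP|v]; first exact.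
apply: (eq_Ck oU _ (IHk _ (DA v))) => x Ux.
by rewrite derive_mx ?mxE//; exact/diff_derivable/dA.
Qed.

Theorem derive_comm m n (U : set V) (f : V -> 'M[R]_(m, n)) x u v :
  open U -> U x -> Ck 2 U f -> 'D_u ('D_v f) x = 'D_v ('D_u f) x.
Proof.
move=> oU Ux Cf; have [df Df] := Cf.
have D w1 w2 : 'D_w1 ('D_w2 f) x = \matrix_(i, j) 'D_w1 ('D_w2 (fun y => f y i j)) x.
  have [dDf _] := Df w2; rewrite derive_mx; last exact/diff_derivable/dDf.
  apply/matrixP => i j; rewrite !mxE.
  apply/near_eq_derive/(near_eq_on oU Ux) => y Uy.
  by rewrite derive_mx ?mxE//; exact/diff_derivable/df.
apply: etrans (D u v) _; apply: etrans (esym (D v u)).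
apply: eq_mx => i j.
exact: (derive_comm_scalar _ _ oU Ux (Ck_coord i j oU Cf)).
Qed.

End Schwarz.

(** * Charts, and maps read in charts *)

Section Charts.
Context {R : realType} {n : nat} {T : topologicalType}.
Implicit Types c : chart R n T.

(** A property of coordinates near [c y] may be checked at points of the manifold: nearby
    coordinates lie in the open image of the chart, and [param] carries them into [V] by
    continuity. *)
Lemma near_coord c (V : set T) y (Q : 'rV[R]_n -> Prop) :
  open V -> V y -> dom c y -> (forall y', V y' -> dom c y' -> Q (c y')) ->
  \forall z \near c y, Q z.
Proof.
move=> oV Vy cy VQ.
have czy : (c @` dom c) (c y) by exists y.
have nV : nbhs (param c (c y)) V by rewrite coordK//; exact: open_nbhs_nbhs.
have nc : nbhs (c y) (c @` dom c).
  by apply: open_nbhs_nbhs; split=> //; exact: codom_open.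
have nP : \forall z \near c y, V (param c z) := param_continuous czy nV.
apply: filterS2 nP nc => z Vz [y' cy' y'z].
by move: Vz; rewrite -y'z coordK// => Vy'; exact: VQ.
Qed.

Lemma open_coord c (V : set T) : open V -> open (c @` (V `&` dom c)).
Proof.
move=> oV; rewrite openE => _ [y [Vy cy] <-].
by apply: (near_coord oV) => // y' Vy' cy'; exists y'.
Qed.

End Charts.

Lemma smooth_map_id (R : realType) (n : nat) (N : manifold R n) :
  smooth_map (@idfun N).
Proof.
split=> [x|p q]; first exact: cvg_id.
have := chart_compat p q; move=> H k; apply: Ck_sub (H k).
by move=> _ [y [[_ py] qy] <-]; exists y.
Qed.

Section LocalMaps.
Context {R : realType} {k n : nat} {M : manifold R k} {N : manifold R n}.
Implicit Types f : M -> N.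

Lemma open_loc_dom f p q (U : set M) : continuous f -> open U ->
  open (loc_dom p q f U).
Proof.
move=> cf oU; rewrite /loc_dom setIAC; apply: open_coord.
apply: openI => //; apply: open_comp; last exact: dom_open.
by move=> ? _; exact: cf.
Qed.

Lemma loc_dom_coord f p q (U : set M) y : U y ->
  dom (chart_at p) y -> dom (chart_at q) (f y) -> loc_dom p q f U (chart_at p y).
Proof. by move=> Uy py qy; exists y. Qed.

Lemma differentiable_loc f p q y : smooth_map f ->
  dom (chart_at p) y -> dom (chart_at q) (f y) ->
  differentiable (loc p q f) (chart_at p y).
Proof.
move=> [_ /(_ p q 1)[df _]] py qy; apply: df; exact: loc_dom_coord.
Qed.

Lemma near_loc f p q y (Q : 'rV[R]_k -> Prop) : continuous f ->
  dom (chart_at p) y -> dom (chart_at q) (f y) ->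
  (forall y', dom (chart_at p) y' -> dom (chart_at q) (f y') ->
    Q (chart_at p y')) ->
  \forall z \near chart_at p y, Q z.
Proof.
move=> cf py qy H.
apply: (@near_coord _ _ _ _ (f @^-1` dom (chart_at q))) => //.
  by apply: open_comp; [move=> ? _; exact: cf|exact: dom_open].
by move=> y' qy' py'; exact: H.
Qed.

Lemma locE f p q y : dom (chart_at p) y -> loc p q f (chart_at p y) = chart_at q (f y).
Proof. by move=> py; rewrite /loc/= coordK. Qed.

End LocalMaps.

(** * Chain rule and changes of charts *)

Section ChainRule.
Context {R : realType} {k n l : nat}.
Context {M : manifold R k} {N : manifold R n} {P : manifold R l}.

Lemma dloc_comp (f : M -> N) (g : N -> P) p q r y :
  smooth_map f -> smooth_map g ->
  dom (chart_at p) y -> dom (chart_at q) (f y) -> dom (chart_at r) (g (f y)) ->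
  dloc p r (g \o f) y = dloc p q f y *m dloc q r g (f y).
Proof.
move=> sf sg py qy ry; have df := differentiable_loc sf py qy.
have dg := differentiable_loc sg qy ry.
(* The intermediate chart at [q] cancels only where it is defined, hence an equality near the
   point. *)
have E : \forall z \near chart_at p y, (loc q r g \o loc p q f) z = loc p r (g \o f) z.
  apply: (near_loc sf.1 py qy) => y' py' qy'.
  by rewrite /= !locE.
rewrite /dloc -(locE f q py) -(jacobian_comp df).
  apply/esym/near_eq_jacobian => //; apply: differentiable_comp => //.
  by rewrite locE.
by rewrite locE.
Qed.

End ChainRule.

Section Transition.
Context {R : realType} {k n : nat} {M : manifold R k} {N : manifold R n}.

Lemma transition1 (q x : N) : dom (chart_at q) x -> transition q q x = 1%:M.
Proof.
move=> qx; rewrite /transition /dloc -(jacobian_id (chart_at q x)).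
apply/esym/near_eq_jacobian => //; apply: (near_loc (f := idfun) _ qx qx).
  exact: (smooth_map_id N).1.
by move=> y' qy' _; rewrite locE.
Qed.

Lemma transition_comp (p q r x : N) : dom (chart_at p) x ->
  dom (chart_at q) x -> dom (chart_at r) x ->
  transition p q x *m transition q r x = transition p r x.
Proof.
move=> px qx rx; rewrite /transition.
by rewrite -(dloc_comp (smooth_map_id N) (smooth_map_id N) px qx rx).
Qed.

Lemma transitionK (p q x : N) : dom (chart_at p) x -> dom (chart_at q) x ->
  transition p q x *m transition q p x = 1%:M.
Proof. by move=> px qx; rewrite transition_comp ?transition1. Qed.

Variable f : M -> N.
Hypothesis sf : smooth_map f.

Lemma dloc_transitionl p p' q y :
  dom (chart_at p) y -> dom (chart_at p') y -> dom (chart_at q) (f y) ->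
  dloc p q f y = transition p p' y *m dloc p' q f y.
Proof.
by move=> py py' qy; rewrite /transition -(dloc_comp (smooth_map_id M) sf).
Qed.

Lemma dloc_transitionr p q q' y :
  dom (chart_at p) y -> dom (chart_at q) (f y) -> dom (chart_at q') (f y) ->
  dloc p q f y *m transition q q' (f y) = dloc p q' f y.
Proof.
by move=> py qy qy'; rewrite /transition -(dloc_comp sf (smooth_map_id N)).
Qed.

(** The charts implicit in [dmap f y] vary with [y]. This relates it to a Jacobian in fixed charts,
    which can be differentiated in [y]. *)
Lemma dmap_loc p q y : dom (chart_at p) y -> dom (chart_at q) (f y) ->
  dmap f y *m transition (f y) q (f y) =
  transition y p y *m jacobian (loc p q f) (chart_at p y).
Proof.
move=> py qy; have yy := chart_at_dom y; have fyy := chart_at_dom (f y).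
by rewrite /dmap dloc_transitionr// (dloc_transitionl yy py).
Qed.

Lemma field_locE p q W y : dom (chart_at p) y ->
  field_loc f p q W (chart_at p y) = W y *m transition (f y) q (f y).
Proof. by move=> py; rewrite /field_loc coordK. Qed.

Lemma field_loc_self W y : field_loc f y (f y) W (chart_at y y) = W y.
Proof. by rewrite field_locE ?transition1 ?mulmx1//; exact: chart_at_dom. Qed.

End Transition.

(** * Coordinate fields and symmetry of the Christoffel symbols *)

Section CoordinateFields.
Context {R : realType} {n : nat} {N : manifold R n}.

(** A field with constant components in the chart at [q]. Hypotheses quantified over vector fields
    on open sets are tested on such fields to obtain identities between vectors at [q]. *)
Definition coord_field (q : N) (u : 'rV[R]_n) (y : N) : 'rV[R]_n :=
  u *m transition q y y.

Lemma coord_field_self q u : coord_field q u q = u.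
Proof. by rewrite /coord_field transition1 ?mulmx1//; exact: chart_at_dom. Qed.

(** Read in the chart at [r], the field is the derivative along [u] of the change of coordinates
    from [q] to [r], composed with the change from [p] to [q]. *)
Lemma vector_field_coord q u : vector_field (dom (chart_at q)) (coord_field q u).
Proof.
move=> p r k.
have oD : open (loc_dom p r (@idfun N) (dom (chart_at q))).
  by apply: open_loc_dom (smooth_map_id N).1 _; exact: dom_open.
have oE a b : open (loc_dom a b (@idfun N) setT).
  by apply: open_loc_dom (smooth_map_id N).1 _; exact: openT.
(* One order more than [k], since the derivative along [u] costs one. *)
have Cg := (smooth_map_id N).2 q r k.+1.
have Cf : Ck k (loc_dom p r (@idfun N) (dom (chart_at q))) (loc p q (@idfun N)).
  apply: Ck_sub ((smooth_map_id N).2 p q k) => _ [y [[qy py] ry] <-].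
  exact: loc_dom_coord.
have := Ck_comp oD (oE q r) _ Cf (Cg.2 u).
have H z : loc_dom p r (@idfun N) (dom (chart_at q)) z ->
    loc_dom q r (@idfun N) setT (loc p q (@idfun N) z).
  by move=> [y [[qy py] ry] <-]; rewrite locE//; exact: loc_dom_coord.
move=> /(_ H); apply: eq_Ck => // _ [y [[qy py] ry] <-] /=.
rewrite locE// field_locE// /coord_field -mulmxA transition_comp//; last first.
  exact: chart_at_dom.
rewrite deriveEjacobian//.
exact: (differentiable_loc (smooth_map_id N)).
Qed.

Lemma field_loc_coord q u y : dom (chart_at q) y ->
  field_loc (@idfun N) q q (coord_field q u) (chart_at q y) = u.
Proof.
move=> qy; rewrite field_locE// /coord_field -mulmxA.
by rewrite transition_comp ?transition1 ?mulmx1//; exact: chart_at_dom.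
Qed.

Lemma Dfield_coord q u v : Dfield (@idfun N) (coord_field q u) q v = 0.
Proof.
rewrite /Dfield -(derive_cst u (chart_at q q) v); apply/esym/near_eq_derive.
have qq := chart_at_dom q.
apply: (near_loc (smooth_map_id N).1 qq qq) => y qy _.
by rewrite field_loc_coord.
Qed.

Lemma dmap_id (q : N) : dmap (@idfun N) q = 1%:M.
Proof. exact: (transition1 (chart_at_dom q)). Qed.

Lemma cov_coord (nabla : connection N) q u w :
  cov nabla idfun (coord_field q u) (coord_field q w) q = christoffel nabla q u w.
Proof. by rewrite /cov Dfield_coord !coord_field_self dmap_id mulmx1 add0r. Qed.

(** Torsion-freeness is applied to coordinate fields, whose bracket vanishes at [q]. *)
Lemma christoffel_sym (g : metric N) (nabla : connection N) (q : N) u w :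
  levi_civita g nabla -> christoffel nabla q u w = christoffel nabla q w u.
Proof.
move=> /(_ _ _ _ (coord_field q u) (@dom_open _ _ _ (chart_at q))
  (vector_field_coord q u) (vector_field_coord q w) (vector_field_coord q u) _
  (chart_at_dom q))[+ _].
by rewrite !cov_coord /lie_bracket !Dfield_coord subrr => /eqP; rewrite subr_eq0 => /eqP.
Qed.

End CoordinateFields.

(** * Covariant derivatives along a map, and their torsion *)

Section TorsionFree.
Context {R : realType} {k n : nat} {M : manifold R k} {N : manifold R n}.
Variables (nabla : connection N) (f : M -> N).
Hypothesis sf : smooth_map f.
Implicit Types X Y : M -> 'rV[R]_k.

Definition push X (y : M) : 'rV[R]_n := X y *m dmap f y.

(* Differentiability at x of the components in the charts chosen at x and f x,
   which is what [Dfield] differentiates. *)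
Definition field_diff (x : M) (W : M -> 'rV[R]_n) : Prop :=
  differentiable (field_loc f x (f x) W) (chart_at x x).

Lemma near_self x (Q : 'rV[R]_k -> Prop) :
  (forall y, dom (chart_at x) y -> dom (chart_at (f x)) (f y) ->
    Q (chart_at x y)) -> \forall z \near chart_at x x, Q z.
Proof.
apply: near_loc; [exact: sf.1|exact: chart_at_dom|exact: chart_at_dom].
Qed.

Lemma field_loc_push x y X :
  dom (chart_at x) y -> dom (chart_at (f x)) (f y) ->
  field_loc f x (f x) (push X) (chart_at x y) =
  field_loc (@idfun M) x x X (chart_at x y) *m
    jacobian (loc x (f x) f) (chart_at x y).
Proof.
move=> xy fxy; rewrite !field_locE// /push -mulmxA (dmap_loc sf xy fxy).
by rewrite mulmxA.
Qed.

Lemma Ck_loc x l : Ck l (loc_dom x (f x) f setT) (loc x (f x) f).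
Proof. exact: sf.2. Qed.

Lemma differentiable_jacobian_loc x :
  differentiable (jacobian (loc x (f x) f)) (chart_at x x).
Proof.
have oE := open_loc_dom (p := x) (q := f x) sf.1 openT.
have [d _] := Ck_jacobian oE (Ck_loc x 2).
by apply: d; apply: loc_dom_coord => //; exact: chart_at_dom.
Qed.

Lemma field_diff_push x X :
  differentiable (field_loc (@idfun M) x x X) (chart_at x x) ->
  field_diff x (push X).
Proof.
move=> dX; rewrite /field_diff.
have := differentiable_mulmx dX (differentiable_jacobian_loc x).
apply: near_eq_differentiable; apply: near_self => y xy fxy.
by rewrite field_loc_push.
Qed.

(** This is the product rule for the components of [X] times the Jacobian of [f]. The second term is
    a second derivative of [f] in charts, which is symmetric in [v] and [X x]. *)
Lemma Dfield_push x X v :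
  differentiable (field_loc (@idfun M) x x X) (chart_at x x) ->
  Dfield f (push X) x v = Dfield idfun X x v *m dmap f x +
    'D_v ('D_(X x) (loc x (f x) f)) (chart_at x x).
Proof.
move=> dX; have dJ := differentiable_jacobian_loc x; have xx := chart_at_dom x.
have fxx := chart_at_dom (f x).
pose G z := field_loc (@idfun M) x x X z *m jacobian (loc x (f x) f) z.
have -> : Dfield f (push X) x v = 'D_v G (chart_at x x).
  by apply/near_eq_derive/near_self => y xy fxy; rewrite field_loc_push.
rewrite derive_mulmx//; congr (_ + _).
rewrite (_ : field_loc _ _ _ _ _ = X x); last exact: (@field_loc_self _ _ _ M M idfun).
(* The vector [X x] is frozen here, so only the Jacobian is differentiated. *)
have E : 'D_v ('D_(X x) (loc x (f x) f)) (chart_at x x) =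
    'D_v (fun z => X x *m jacobian (loc x (f x) f) z) (chart_at x x).
  apply/near_eq_derive/near_self => y xy fxy.
  exact/deriveEjacobian/differentiable_loc.
rewrite {}E (derive_mulmx _ (differentiable_cst (X x) _) dJ).
by rewrite derive_cst mul0mx add0r.
Qed.

(** The two covariant derivatives share the term [s], by symmetry of second derivatives, and the
    term [c], by symmetry of the Christoffel symbols. Their difference is the bracket pushed
    forward. *)
Lemma cov_push_torsion (g : metric N) x X Y : levi_civita g nabla ->
  differentiable (field_loc (@idfun M) x x X) (chart_at x x) ->
  differentiable (field_loc (@idfun M) x x Y) (chart_at x x) ->
  cov nabla f X (push Y) x - cov nabla f Y (push X) x =
  lie_bracket X Y x *m dmap f x.
Proof.
move=> LC dX dY; rewrite /lie_bracket mulmxBl.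
have oE := open_loc_dom (p := x) (q := f x) sf.1 openT.
have xE : loc_dom x (f x) f setT (chart_at x x).
  by apply: loc_dom_coord => //; exact: chart_at_dom.
pose s := 'D_(X x) ('D_(Y x) (loc x (f x) f)) (chart_at x x).
pose c := christoffel nabla (f x) (push X x) (push Y x).
have -> : cov nabla f X (push Y) x =
    Dfield idfun Y x (X x) *m dmap f x + (s + c).
  by rewrite /cov Dfield_push// addrA.
have -> : cov nabla f Y (push X) x =
    Dfield idfun X x (Y x) *m dmap f x + (s + c).
  have sE : 'D_(Y x) ('D_(X x) (loc x (f x) f)) (chart_at x x) = s.
    exact: (derive_comm (Y x) (X x) oE xE (Ck_loc x 2)).
  rewrite /cov (Dfield_push _ dX) sE -addrA.
  by rewrite /c (christoffel_sym _ _ _ LC).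
have addKB (a b t : 'rV[R]_n) : a + t - (b + t) = a - b.
  by rewrite opprD addrACA subrr addr0.
exact: addKB.
Qed.

Lemma covB (X : M -> 'rV[R]_k) W W' x : field_diff x W -> field_diff x W' ->
  cov nabla f X (fun y => W y - W' y) x = cov nabla f X W x - cov nabla f X W' x.
Proof.
move=> dW dW'; rewrite /cov /Dfield.
have -> : field_loc f x (f x) (fun y => W y - W' y) =
    field_loc f x (f x) W - field_loc f x (f x) W'.
  by apply/funext => z; rewrite /field_loc mulmxBl.
rewrite deriveB; try exact: diff_derivable.
have L := christoffel_linearr nabla (f x) (X x *m dmap f x).
have -> : W x - W' x = -1 *: W' x + W x by rewrite scaleN1r addrC.
rewrite L scaleN1r [- _ + christoffel _ _ _ _]addrC.
by rewrite opprD addrACA.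
Qed.

Lemma covN (X : M -> 'rV[R]_k) W x : field_diff x W ->
  cov nabla f X (fun y => - W y) x = - cov nabla f X W x.
Proof.
move=> dW; rewrite /cov /Dfield.
have -> : field_loc f x (f x) (fun y => - W y) = - field_loc f x (f x) W.
  by apply/funext => z; rewrite /field_loc mulNmx.
rewrite deriveN; last exact: diff_derivable.
have L := christoffel_linearr nabla (f x) (X x *m dmap f x).
have c0 : christoffel nabla (f x) (X x *m dmap f x) 0 = 0.
  by have := L (-1) 0 0; rewrite scaler0 addr0 scaleN1r addNr.
have -> : - W x = -1 *: W x + 0 by rewrite scaleN1r addr0.
by rewrite L scaleN1r c0 addr0 opprD.
Qed.

Lemma near_eq_cov (X : M -> 'rV[R]_k) (U : set M) W W' x : open U -> U x ->
  (forall y, U y -> W y = W' y) -> cov nabla f X W x = cov nabla f X W' x.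
Proof.
move=> oU Ux WW'; rewrite /cov (WW' x Ux).
have -> // : Dfield f W x (X x) = Dfield f W' x (X x).
apply/near_eq_derive/(near_coord oU Ux (chart_at_dom x)) => y Uy xy.
by rewrite !field_locE// WW'.
Qed.

End TorsionFree.

(** * The tensor phi along a map *)

Lemma derive_chain (R : realType) (U V W : normedModType R) (f : U -> V)
    (g : V -> W) x v y w : differentiable f x -> differentiable g y ->
  f x = y -> 'D_v f x = w -> 'D_v (g \o f) x = 'D_w g y.
Proof.
move=> df dg fx <-; rewrite -{}fx in dg *.
rewrite (deriveE _ (differentiable_comp df dg)).
by rewrite (deriveE _ dg) (deriveE _ df) diff_comp.
Qed.

Lemma mulmx_conj_cancel (R : pzRingType) l n p q (w : 'M[R]_(l, n)) (A : 'M[R]_(n, p))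
    (B : 'M[R]_(p, n)) (P : 'M[R]_(n, q)) (C : 'M[R]_(q, p)) :
  A *m B = 1%:M -> w *m A *m (B *m P *m C) = w *m P *m C.
Proof. by move=> AB; rewrite !mulmxA -(mulmxA w) AB mulmx1. Qed.

Section PhiParallel.
Context {R : realType} {m : nat} {N : manifold R (2 * m).+1}.
Variables (S : almost_contact_metric N) (nabla : connection N).

Definition phi_loc (q : N) (z : 'rV[R]_((2 * m).+1)) : 'M[R]_((2 * m).+1) :=
  let y := param (chart_at q) z in
  transition q y y *m phi S y *m transition y q y.

Lemma differentiable_phi_loc q : differentiable (phi_loc q) (chart_at q q).
Proof.
have [d _] := phi_smooth S q 1; apply: d.
by exists q => //; exact: chart_at_dom.
Qed.

Lemma phi_loc_self q : phi_loc q (chart_at q q) = phi S q.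
Proof.
by rewrite /phi_loc coordK ?transition1 ?mul1mx ?mulmx1//; exact: chart_at_dom.
Qed.

Section AlongMap.
Context {k : nat} {M : manifold R k}.
Variable f : M -> N.
Hypothesis sf : smooth_map f.

Definition phi_along (W : M -> 'rV[R]_((2 * m).+1)) (y : M) :
  'rV[R]_((2 * m).+1) := W y *m phi S (f y).

Lemma field_loc_phi x y W :
  dom (chart_at x) y -> dom (chart_at (f x)) (f y) ->
  field_loc f x (f x) (phi_along W) (chart_at x y) =
  field_loc f x (f x) W (chart_at x y) *m
    (phi_loc (f x) \o loc x (f x) f) (chart_at x y).
Proof.
move=> xy fxy; rewrite /comp locE// !field_locE// /phi_along /phi_loc coordK//.
exact/esym/mulmx_conj_cancel/transitionK/fxy/chart_at_dom.
Qed.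

Lemma differentiable_loc_self x : differentiable (loc x (f x) f) (chart_at x x).
Proof.
by apply: differentiable_loc => //; exact: chart_at_dom.
Qed.

Lemma loc_self x : loc x (f x) f (chart_at x x) = chart_at (f x) (f x).
Proof. by rewrite locE//; exact: chart_at_dom. Qed.

Lemma differentiable_phi_loc_comp x :
  differentiable (phi_loc (f x) \o loc x (f x) f) (chart_at x x).
Proof.
apply: differentiable_comp; first exact: differentiable_loc_self.
by rewrite loc_self; exact: differentiable_phi_loc.
Qed.

Lemma field_diff_phi x W : field_diff f x W -> field_diff f x (phi_along W).
Proof.
move=> dW; have := differentiable_mulmx dW (differentiable_phi_loc_comp x).
apply: near_eq_differentiable; apply: (near_self sf) => y xy fxy.
by rewrite field_loc_phi.
Qed.

Lemma derive_phi_loc_comp x v :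
  'D_v (phi_loc (f x) \o loc x (f x) f) (chart_at x x) =
  'D_(v *m dmap f x) (phi_loc (f x)) (chart_at (f x) (f x)).
Proof.
have dl := differentiable_loc_self x.
exact: derive_chain dl (differentiable_phi_loc _) (loc_self x) (deriveEjacobian v dl).
Qed.

(** In the product rule, the derivative of the components of phi along [f] depends on [v] only
    through its image under the differential of [f], so it is a derivative taken in [N]. *)
Lemma Dfield_phi x W v : field_diff f x W ->
  Dfield f (phi_along W) x v = Dfield f W x v *m phi S (f x) +
    W x *m 'D_(v *m dmap f x) (phi_loc (f x)) (chart_at (f x) (f x)).
Proof.
move=> dW; have dP := differentiable_phi_loc_comp x.
pose G z := field_loc f x (f x) W z *m (phi_loc (f x) \o loc x (f x) f) z.
have -> : Dfield f (phi_along W) x v = 'D_v G (chart_at x x).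
  by apply/near_eq_derive/(near_self sf) => y xy fxy; rewrite field_loc_phi.
rewrite (derive_mulmx _ dW dP) derive_phi_loc_comp field_loc_self.
by rewrite /comp loc_self phi_loc_self.
Qed.

End AlongMap.

Hypothesis cos : cosymplectic S nabla.

(* The parallelism of phi at q in coordinates, tested on coordinate fields. *)
Lemma christoffel_phi (q : N) (u w : 'rV[R]_((2 * m).+1)) :
  w *m 'D_u (phi_loc q) (chart_at q q) + christoffel nabla q u (w *m phi S q) =
  christoffel nabla q u w *m phi S q.
Proof.
have [_ [/(_ _ _ _ (@dom_open _ _ _ (chart_at q)) (vector_field_coord q u)
  (vector_field_coord q w) _ (chart_at_dom q)) + _]] := cos.
rewrite /phi_field cov_coord => /eqP; rewrite subr_eq0 => /eqP <-.
have dC : field_diff (@idfun N) q (coord_field q w).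
  apply: near_eq_differentiable (differentiable_cst w _).
  by apply: (near_self (smooth_map_id N)) => y qy _; rewrite field_loc_coord.
have := Dfield_phi (smooth_map_id N) u dC.
rewrite /phi_along dmap_id mulmx1 Dfield_coord mul0mx add0r coord_field_self.
by rewrite /cov !coord_field_self dmap_id mulmx1 /= => ->.
Qed.

(** The derivative of phi in [Dfield_phi] involves only vectors at [f x], so the pointwise identity
    [christoffel_phi] applies even though [W] and [X] need not extend to [N]. *)
Lemma cov_phi k (M : manifold R k) (f : M -> N) (X : M -> 'rV[R]_k) W x :
  smooth_map f -> field_diff f x W ->
  cov nabla f X (phi_along f W) x = cov nabla f X W x *m phi S (f x).
Proof.
move=> sf dW; rewrite /cov (Dfield_phi sf _ dW) mulmxDl -christoffel_phi.
by rewrite addrA.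
Qed.

End PhiParallel.

(** * The tangential projection along an immersion *)

Lemma invmx_mul3 (R : comUnitRingType) n (A B C : 'M[R]_n) :
  A \in unitmx -> B \in unitmx -> C \in unitmx ->
  invmx (A *m B *m C) = invmx C *m invmx B *m invmx A.
Proof.
move=> uA uB uC; have uABC : A *m B *m C \in unitmx by rewrite !unitmx_mul uA uB.
apply: (can_inj (mulmxK uABC)); rewrite mulVmx//.
rewrite -!mulmxA (mulmxA (invmx A)) mulVmx// mul1mx (mulmxA (invmx B)).
by rewrite mulVmx// mul1mx mulVmx.
Qed.

(** If the Gram matrix kills [v], then [v *m A] has zero square length, so it vanishes, and [v = 0]
    by row freeness. *)
Lemma gram_unit (R : realType) n k (G : 'M[R]_n) (A : 'M[R]_(k, n)) :
  (forall u, u != 0 -> 0 < scal G u u) -> row_free A ->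
  A *m G *m A^T \in unitmx.
Proof.
move=> Gpos Afree; rewrite -row_free_unit; apply: inj_row_free => v v0.
apply: (row_free_inj Afree); rewrite mul0mx; apply/eqP/negPn/negP => /Gpos.
rewrite /scal trmx_mul -!mulmxA; rewrite -!mulmxA in v0.
by rewrite (mulmxA v) (mulmxA (v *m A)) -(mulmxA v) !mulmxA in v0 *; rewrite v0 mul0mx mxE ltxx.
Qed.

(** Orthogonal projection onto a row space does not depend on the bases: [P] changes the basis of
    the subspace and [Q] that of the ambient space, and both cancel in the formula given by the
    normal equations. *)
Lemma projector_change_basis (R : comUnitRingType) n k (P : 'M[R]_k)
    (J d : 'M[R]_(k, n)) (Q Q' g : 'M[R]_n) :
  P \in unitmx -> Q *m Q' = 1%:M -> d *m Q = P *m J ->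
  d *m g *m d^T \in unitmx ->
  let G := Q' *m g *m Q'^T in
  J *m G *m J^T \in unitmx /\
  forall w : 'rV_n, w *m g *m d^T *m invmx (d *m g *m d^T) *m d *m Q =
    w *m Q *m G *m J^T *m invmx (J *m G *m J^T) *m J.
Proof.
move=> uP QQ' dQ uI G; have dE : d = P *m J *m Q' by rewrite -dQ -mulmxA QQ' mulmx1.
have Q'Q := mulmx1C QQ'.
have gE : g = Q *m G *m Q^T.
  by rewrite /G !mulmxA QQ' mul1mx -mulmxA -trmx_mul QQ' trmx1 mulmx1.
have gd : g *m d^T = Q *m G *m J^T *m P^T.
  rewrite dE gE !trmx_mul !mulmxA -[_ *m Q^T *m _]mulmxA -trmx_mul Q'Q trmx1.
  by rewrite mulmx1.
have dgd : d *m g *m d^T = P *m (J *m G *m J^T) *m P^T.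
  by rewrite -mulmxA gd dE -(mulmxA (P *m J)) !(mulmxA Q') Q'Q mul1mx !mulmxA.
have uK : J *m G *m J^T \in unitmx.
  by move: uI; rewrite dgd unitmx_mul => /andP[]; rewrite unitmx_mul => /andP[].
have uPT : P^T \in unitmx by rewrite unitmx_tr.
split=> // w; rewrite -[w *m g *m _]mulmxA gd dgd invmx_mul3// -mulmxA dQ !mulmxA.
by rewrite (mulmxK uPT) (mulmxKV uP).
Qed.

Section Projection.
Context {R : realType} {m k : nat} {N : manifold R (2 * m).+1}.
Context {M : manifold R k}.
Variables (S : almost_contact_metric N) (iota : M -> N).
Hypothesis imm : immersion iota.

Definition gram_loc (q : N) (z : 'rV[R]_((2 * m).+1)) : 'M[R]_((2 * m).+1) :=
  let y := param (chart_at q) z in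
  transition q y y *m S y *m (transition q y y)^T.

Lemma differentiable_gram_loc q : differentiable (gram_loc q) (chart_at q q).
Proof.
have [d _] := gram_smooth S q 1; apply: d.
by exists q => //; exact: chart_at_dom.
Qed.

Lemma induced_unit x : induced_metric S iota x \in unitmx.
Proof. by apply: gram_unit; [exact: gram_pos|exact: imm.2]. Qed.

(* J, G and Q are the differential of iota, the metric, and the change of
   components from the chart chosen at iota y, read in the charts of x and
   iota x; the right-hand side depends differentiably on y. *)
Lemma tan_part_loc x y (w : 'rV[R]_((2 * m).+1)) :
  dom (chart_at x) y -> dom (chart_at (iota x)) (iota y) ->
  let J := jacobian (loc x (iota x) iota) (chart_at x y) in
  let G := gram_loc (iota x) (chart_at (iota x) (iota y)) in
  let Q := transition (iota y) (iota x) (iota y) in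
  J *m G *m J^T \in unitmx /\
  tan_part S iota y w *m dmap iota y *m Q =
  w *m Q *m G *m J^T *m invmx (J *m G *m J^T) *m J.
Proof.
move=> xy qy J G Q; have yy := chart_at_dom y; have iyy := chart_at_dom (iota y).
have uP : transition y x y \in unitmx := (mulmx1_unit (transitionK yy xy)).1.
have [uK tE] := projector_change_basis uP (transitionK iyy qy)
  (dmap_loc imm.1 xy qy) (induced_unit y).
have GE : G = transition (iota x) (iota y) (iota y) *m S (iota y) *m
    (transition (iota x) (iota y) (iota y))^T by rewrite /G /gram_loc coordK.
by clearbody G; subst G; split; [exact: uK|exact: tE].
Qed.

(** By [tan_part_loc], the projected field read in fixed charts is a product of differentiable
    matrices, one of them an inverse. *)
Lemma field_diff_tan x W : field_diff iota x W ->
  field_diff iota x (fun y => tan_part S iota y (W y) *m dmap iota y).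
Proof.
move=> dW; have sf := imm.1; have xx := chart_at_dom x.
have qq := chart_at_dom (iota x).
pose J := jacobian (loc x (iota x) iota).
pose G := gram_loc (iota x) \o loc x (iota x) iota.
have dJ : differentiable J (chart_at x x) by exact: differentiable_jacobian_loc.
have dG : differentiable G (chart_at x x).
  apply: differentiable_comp; first exact: differentiable_loc_self.
  by rewrite loc_self; exact: differentiable_gram_loc.
have dJT := differentiable_trmx dJ.
pose K z := J z *m G z *m (J z)^T.
have dK : differentiable K (chart_at x x).
  exact: (differentiable_mulmx (differentiable_mulmx dJ dG) dJT).
have uK : K (chart_at x x) \in unitmx.
  have [+ _] := tan_part_loc 0 xx qq.
  by rewrite /K /G /comp loc_self.
have dKi : differentiable (fun z => invmx (K z)) (chart_at x x).
  exact: differentiable_invmx.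
have := differentiable_mulmx (differentiable_mulmx (differentiable_mulmx
  (differentiable_mulmx dW dG) dJT) dKi) dJ.
apply: near_eq_differentiable; apply: (near_self sf) => y xy qy.
have [_ E] := tan_part_loc (W y) xy qy.
have GE : G (chart_at x y) = gram_loc (iota x) (chart_at (iota x) (iota y)).
  by rewrite /G /comp locE.
apply/esym; apply: etrans (field_locE iota (iota x) _ xy) _.
by apply: etrans E _; rewrite /K GE (field_locE iota (iota x) W xy).
Qed.

End Projection.

(** * Algebra of an almost contact metric structure at a point *)

Section AlmostContact.
Context {R : realType} {m : nat} {N : manifold R (2 * m).+1}.
Variables (S : almost_contact_metric N) (x : N).
Implicit Types u v : 'rV[R]_((2 * m).+1).

Lemma scal_eq0P n (G : 'M[R]_n) (u v : 'rV[R]_n) :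
  scal G u v = 0 <-> u *m G *m v^T = 0.
Proof.
rewrite /scal; split=> [uv|->]; last by rewrite mxE.
by rewrite [LHS]mx11_scalar uv -scalemx1 scale0r.
Qed.

Lemma scalC (g : metric N) u v : scal (g x) u v = scal (g x) v u.
Proof.
rewrite /scal -[in LHS](trmxK (u *m g x *m v^T)) mxE !trmx_mul trmxK gram_sym.
by rewrite mulmxA.
Qed.

Lemma eta_mx u : u *m eta S x = ((u *m eta S x) 0 0)%:M.
Proof. exact: mx11_scalar. Qed.

(** Let [w] be the image of xi under phi. As phi squared kills xi, phi kills [w], and [phi_sqr] at
    [w] gives [w = t *: xi S x]. Applying phi once more yields [t *: w = 0], so [w = 0] in either
    case. *)
Lemma xi_phi : xi S x *m phi S x = 0.
Proof.
set w := xi S x *m phi S x; set t := (w *m eta S x) 0 0.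
have xi1 : xi S x *m eta S x = 1%:M by rewrite eta_mx eta_xi.
have w0 : w *m phi S x = 0 by rewrite /w phi_sqr xi1 mul1mx addNr.
have w1 : w = t *: xi S x.
  have := phi_sqr S x w; rewrite w0 mul0mx eta_mx mul_scalar_mx => /esym/eqP.
  by rewrite addrC subr_eq0 => /eqP.
have : t *: w = 0 by rewrite -w0 {2}w1 -scalemxAl.
move=> /eqP; rewrite scaler_eq0 => /orP[/eqP t0|/eqP//].
by rewrite w1 t0 scale0r.
Qed.

Lemma scal_xi u : scal (S x) u (xi S x) = (u *m eta S x) 0 0.
Proof.
have := phi_metric S x u (xi S x); rewrite xi_phi eta_xi mulr1 /scal trmx0 mulmx0.
by rewrite mxE => /esym/eqP; rewrite subr_eq0 => /eqP.
Qed.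

Lemma phi_sqr_horizontal u :
  (u *m eta S x) 0 0 = 0 -> u *m phi S x *m phi S x = - u.
Proof.
by move=> u0; rewrite phi_sqr eta_mx u0 mul_scalar_mx scale0r addr0.
Qed.

(** Comparison with [phi_sqr] leaves eta(u) xi = 0, to which eta is applied. *)
Lemma phi_sqr_eqN u :
  u *m phi S x *m phi S x = - u -> (u *m eta S x) 0 0 = 0.
Proof.
rewrite phi_sqr -[RHS]addr0 => /addrI; rewrite eta_mx mul_scalar_mx.
set t := (u *m eta S x) 0 0 => /(congr1 (fun w => (w *m eta S x) 0 0)) /=.
by rewrite -scalemxAl mul0mx [LHS]mxE eta_xi mulr1 => ->; rewrite !mxE mul0rn.
Qed.

End AlmostContact.

(** * The normal projection and the operator F *)

Section Submanifold.
Context {R : realType} {m k : nat} {N : manifold R (2 * m).+1}.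
Context {M : manifold R k}.
Variables (S : almost_contact_metric N) (iota : M -> N).
Hypothesis imm : immersion iota.
Implicit Types (x : M) (u v : 'rV[R]_k) (w : 'rV[R]_((2 * m).+1)).

(** In matrix form, the linearity of the normal projection becomes distributivity of the matrix
    product. *)
Definition nor_mx x : 'M[R]_((2 * m).+1) :=
  1%:M - S (iota x) *m (dmap iota x)^T *m invmx (induced_metric S iota x)
    *m dmap iota x.

Lemma nor_partE x w : nor_part S iota x w = w *m nor_mx x.
Proof. by rewrite /nor_part /tan_part /nor_mx mulmxBr mulmx1 !mulmxA. Qed.

Lemma tan_part_tangent x u : tan_part S iota x (u *m dmap iota x) = u.
Proof.
rewrite /tan_part -!mulmxA (mulmxA (dmap iota x)) (mulmxA _ _ (invmx _)).
by rewrite mulmxV ?mulmx1//; exact: induced_unit.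
Qed.

Lemma nor_part_normal x w :
  (w <= Defs.normal_space S iota x)%MS -> nor_part S iota x w = w.
Proof.
move=> /sub_kermxP w0; rewrite /nor_part /tan_part -(mulmxA w) w0.
by rewrite !mul0mx subr0.
Qed.

Definition Fmx x : 'M[R]_(k, (2 * m).+1) :=
  dmap iota x *m phi S (iota x) *m nor_mx x.

Lemma FmxE x u : nor_part S iota x (phi_tan S iota x u) = u *m Fmx x.
Proof. by rewrite nor_partE /phi_tan /Fmx !mulmxA. Qed.

Lemma FimageE (D : M -> 'M[R]_k) x : Fimage S iota D x = D x *m Fmx x.
Proof. by apply/row_matrixP => i; rewrite rowK FmxE row_mul. Qed.

(** * Gauss and Weingarten formulae, and the bracket *)

Section Bracket.
Variable nabla : connection N.
Hypothesis LC : levi_civita S nabla.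
Hypothesis cos : cosymplectic S nabla.
Variables (U : set M) (x : M).
Hypotheses (Ux : U x) (oU : open U).

Lemma vector_field_diff Z : vector_field U Z ->
  differentiable (field_loc (@idfun M) x x Z) (chart_at x x).
Proof.
move=> /(_ x x 1)[d _]; apply: d; apply: loc_dom_coord => //; exact: chart_at_dom.
Qed.

Lemma sff_nabla_perp X Z : vector_field U Z ->
  sff S nabla iota X (Tpart S iota Z) x + nabla_perp S nabla iota X (Fpart S iota Z) x
  = cov nabla iota X (push iota Z) x *m phi S (iota x) *m nor_mx x.
Proof.
move=> /vector_field_diff/(field_diff_push imm.1) dZ.
have dP := field_diff_phi S imm.1 dZ; have dT := field_diff_tan S imm dP.
rewrite /sff /nabla_perp !nor_partE -mulmxDl -(cov_phi cos X imm.1 dZ).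
(* FZ is phi Z minus its tangential part TZ. Both are differentiable, so [covB] splits the
   derivative, and the TZ term cancels against the one in h(X, TZ). *)
rewrite (_ : Fpart S iota Z = fun y => phi_along S iota (push iota Z) y -
  tan_part S iota y (phi_along S iota (push iota Z) y) *m dmap iota y)//.
rewrite (covB nabla X dP dT).
by congr (_ *m _); rewrite addrC subrK.
Qed.

Lemma normal_bracket X Y : vector_field U X -> vector_field U Y ->
  sff S nabla iota X (Tpart S iota Y) x - sff S nabla iota Y (Tpart S iota X) x
  + nabla_perp S nabla iota X (Fpart S iota Y) x
  - nabla_perp S nabla iota Y (Fpart S iota X) x = lie_bracket X Y x *m Fmx x.
Proof.
move=> vX vY; have addBB (a b c d e f : 'rV[R]_((2 * m).+1)) :
    a + c = e -> b + d = f -> a - b + c - d = e - f.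
  by move=> <- <-; rewrite -addrA addrACA -opprD.
apply: etrans (addBB _ _ _ _ _ _ (sff_nabla_perp X vY) (sff_nabla_perp Y vX)) _.
have T := cov_push_torsion imm.1 LC (vector_field_diff vX) (vector_field_diff vY).
by rewrite -!mulmxBl T /Fmx !mulmxA.
Qed.

(* If Y is orthogonal to xi then phi (phi Y) = - Y near x, and phi^2 commutes
   with the covariant derivative. *)
Lemma eta_cov X Z : vector_field U Z ->
  (forall y, U y -> (push iota Z y *m eta S (iota y)) 0 0 = 0) ->
  (cov nabla iota X (push iota Z) x *m eta S (iota x)) 0 0 = 0.
Proof.
move=> /vector_field_diff/(field_diff_push imm.1) dZ Z0.
have dP := field_diff_phi S imm.1 dZ.
apply: phi_sqr_eqN.
rewrite -(cov_phi cos X imm.1 dZ) -(cov_phi cos X imm.1 dP).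
rewrite -(covN nabla X dZ).
apply: (near_eq_cov nabla iota X oU Ux) => y Uy.
exact/phi_sqr_horizontal/Z0.
Qed.

(** The bracket, pushed forward, is a difference of two covariant derivatives, each killed by eta
    according to [eta_cov]. *)
Lemma eta_bracket X Y : vector_field U X -> vector_field U Y ->
  (forall y, U y -> (push iota X y *m eta S (iota y)) 0 0 = 0) ->
  (forall y, U y -> (push iota Y y *m eta S (iota y)) 0 0 = 0) ->
  (lie_bracket X Y x *m dmap iota x *m eta S (iota x)) 0 0 = 0.
Proof.
move=> vX vY X0 Y0.
rewrite -(cov_push_torsion imm.1 LC (vector_field_diff vX) (vector_field_diff vY)).
have := eta_cov X vY Y0; have := eta_cov Y vX X0.
move: (cov _ _ X _ _) (cov _ _ Y _ _) => a b b0 a0.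
by rewrite mulmxBl mxE a0 mxE b0 subr0.
Qed.

End Bracket.

(** * Orthogonality of the images under F *)

Hypothesis xiM : xi_tangent S iota.

Lemma xi_onE x : xi_on S iota x *m dmap iota x = xi S (iota x).
Proof. by have /submxP[c E] := xiM x; rewrite /xi_on E tan_part_tangent. Qed.

Lemma eta_orthogonal x r (D : 'M[R]_(r, k)) u :
  orthogonal_at S iota x D (xi_on S iota x) -> (u <= D)%MS ->
  (u *m dmap iota x *m eta S (iota x)) 0 0 = 0.
Proof.
move=> orth /submx_trans/(_ orth)/sub_kermxP u0.
rewrite -scal_xi; apply/scal_eq0P; rewrite -xi_onE trmx_mul -u0.
by rewrite /induced_metric !mulmxA.
Qed.

(** Since phi v is normal, Fu may be replaced by phi u, and [phi_metric] gives g(phi u, phi v) =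
    g(u, v) - eta(u) eta(v), where g(u, v) and eta(v) vanish. *)
Lemma F_orthogonal x r s (D : 'M[R]_(r, k)) (E : 'M[R]_(s, k)) u v :
  orthogonal_at S iota x D E -> orthogonal_at S iota x E (xi_on S iota x) ->
  (u <= D)%MS -> (v <= E)%MS ->
  (phi_tan S iota x v <= Defs.normal_space S iota x)%MS ->
  scal (S (iota x)) (u *m Fmx x) (phi_tan S iota x v) = 0.
Proof.
move=> DE Exi uD vE vN; have v0 := eta_orthogonal Exi vE.
have uv0 : scal (S (iota x)) (u *m dmap iota x) (v *m dmap iota x) = 0.
  move: (submx_trans uD DE) => /sub_kermxP; have /submxP[c ->] := vE => u0.
  apply/scal_eq0P; move: u0; rewrite /induced_metric !trmx_mul !mulmxA => ->.
  by rewrite mul0mx.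
have tv0 t : scal (S (iota x)) (t *m dmap iota x) (phi_tan S iota x v) = 0.
  move: vN => /sub_kermxP vN; rewrite scalC; apply/scal_eq0P.
  by rewrite trmx_mul mulmxA -(mulmxA (phi_tan _ _ _ _)) vN mul0mx.
have /scal_eq0P t0 := tv0 (tan_part S iota x (phi_tan S iota x u)).
apply/scal_eq0P; rewrite -FmxE /nor_part !mulmxBl t0 subr0; apply/scal_eq0P.
by rewrite phi_metric uv0 v0 mulr0 subr0.
Qed.

Lemma mu_orthogonal x w v : (w <= mu S iota x)%MS ->
  scal (S (iota x)) w (phi_tan S iota x v) = 0.
Proof.
rewrite sub_capmx => /andP[_ /sub_kermxP w0]; apply/scal_eq0P.
by rewrite /phi_tan -(mulmxA v) trmx_mul mulmxA -(mulmxA w) w0 mul0mx.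
Qed.

(** Here Fv = phi v is orthogonal to mu and to the image of [D], hence to itself, so phi v = 0.
    Applying phi again gives v = 0, because eta(v) = 0 and the differential of [iota] is
    injective. *)
Lemma totally_real_F_eq0 x (D E : M -> 'M[R]_k) v :
  orthogonal_at S iota x (D x) (E x) ->
  orthogonal_at S iota x (E x) (xi_on S iota x) -> (v <= E x)%MS ->
  (phi_tan S iota x v <= Defs.normal_space S iota x)%MS ->
  (v *m Fmx x <= mu S iota x + Fimage S iota D x)%MS -> v = 0.
Proof.
move=> DE Exi vE vN; have v0 := eta_orthogonal Exi vE.
rewrite -FmxE nor_part_normal// => /sub_addsmxP[[a b] /= E1].
have F0 : phi_tan S iota x v = 0.
  apply/eqP/negPn/negP => /(gram_pos S (iota x)); rewrite {1}E1 FimageE mulmxA.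
  rewrite /scal mulmxDl mulmxDl mxE -!/(scal _ _ _).
  rewrite (F_orthogonal DE Exi (submxMl _ _) vE vN).
  by rewrite (mu_orthogonal _ (submxMl _ _)) addr0 ltxx.
apply: (row_free_inj (imm.2 x)); rewrite mul0mx.
apply: oppr_inj; rewrite oppr0 -(phi_sqr_horizontal v0).
by move: F0; rewrite /phi_tan => ->; rewrite mul0mx.
Qed.

End Submanifold.

Theorem theorem3p8 (R : realType) (m k : nat)
    (N : manifold R (2 * m).+1) (S : almost_contact_metric N)
    (nabla : connection N) (M : manifold R k) (iota : M -> N)
    (Dtheta Dperp : M -> 'M[R]_k) (theta : R)
    (nablaLC : levi_civita S nabla)
    (Ncosymplectic : cosymplectic S nabla)
    (iota_immersion : immersion iota) (iota_inj : injective iota)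
    (xiM : xi_tangent S iota)
    (Mhemislant : hemi_slant S iota Dtheta Dperp theta) :
  integrable_distribution Dtheta <->
  (forall (U : set M) (X Y : M -> 'rV[R]_k), open U ->
     section_on Dtheta U X -> section_on Dtheta U Y ->
     forall x, U x ->
       (sff S nabla iota X (Tpart S iota Y) x
        - sff S nabla iota Y (Tpart S iota X) x
        + nabla_perp S nabla iota X (Fpart S iota Y) x
        - nabla_perp S nabla iota Y (Fpart S iota X) x
        <= mu S iota x + Fimage S iota Dtheta x)%MS).
Proof.
have [spanTM orth _ _ [_ real]] := Mhemislant.
have etaD (U : set M) Z : section_on Dtheta U Z ->
    forall y, U y -> (push iota Z y *m eta S (iota y)) 0 0 = 0.
  move=> [_ ZD] y Uy; have [_ Dxi _] := orth y.
  exact: (eta_orthogonal iota_immersion xiM Dxi (ZD y Uy)).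
split=> [integ|H] U X Y oU sX sY x Ux.
  (* If the bracket lies in the slant distribution, the expression F[X, Y] already lies in its image
     under F, without any mu component. *)
  rewrite (normal_bracket iota_immersion nablaLC Ncosymplectic Ux sX.1 sY.1).
  rewrite FimageE; apply: submx_trans (addsmxSr _ _).
  exact/submxMr/(integ U X Y).
have [DE Dxi Exi] := orth x.
have := H U X Y oU sX sY x Ux.
rewrite (normal_bracket iota_immersion nablaLC Ncosymplectic Ux sX.1 sY.1).
have := eta_bracket iota_immersion nablaLC Ncosymplectic Ux oU sX.1 sY.1
  (etaD _ _ sX) (etaD _ _ sY).
set L := lie_bracket X Y x => L0 LF.
have : (L <= Dtheta x + Dperp x + xi_on S iota x)%MS.
  by rewrite (submx_trans (submx1 L))//; have /andP[] := spanTM x.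
move=> /sub_addsmxP[[w c] /= E].
have /sub_addsmxP[[a b] /= wE] : (w *m (Dtheta x + Dperp x)%MS <= Dtheta x + Dperp x)%MS.
  exact: submxMl.
(* Eta vanishes on both distributions and eta(xi) = 1, so the 1 x 1 matrix [c] is eta of the
   bracket, which is zero. *)
have c0 : c = 0.
  have a0 := eta_orthogonal iota_immersion xiM Dxi (submxMl a (Dtheta x)).
  have b0 := eta_orthogonal iota_immersion xiM Exi (submxMl b (Dperp x)).
  have xi1 : xi S (iota x) *m eta S (iota x) = 1%:M by rewrite eta_mx eta_xi.
  move: L0; rewrite E wE !mulmxDl mxE [X in X + _]mxE a0 b0 !add0r.
  rewrite -(mulmxA c) (xi_onE iota_immersion xiM) -mulmxA xi1 mulmx1 => c00.
  by apply/matrixP => i j; rewrite !ord1 c00 mxE.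
move: E; rewrite c0 mul0mx addr0 wE => E.
have b0 : b *m Dperp x = 0.
  apply: (totally_real_F_eq0 iota_immersion xiM DE Exi (submxMl _ _)).
    by apply: real; exact: submxMl.
  (* F of the right-hand side lies in mu + F(D^theta): the first term by hypothesis, the second by
     definition of the image. *)
  have -> : b *m Dperp x = L - a *m Dtheta x by rewrite E addrC addKr.
  rewrite mulmxBl addmx_sub// eqmx_opp -mulmxA.
  by rewrite (submx_trans _ (addsmxSr _ _))// FimageE submxMl.
by rewrite E b0 addr0 submxMl.
Qed.
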